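(* Let $X$ be a compact smooth manifold and let $\mathcal P_\sigma$ be a principal $\mathbf{PU}(\mathcal H_+)$-bundle over $X$ defined by $\sigma:X\to K(\mathbb Z,3)$. Then the odd twisted K-group $K^1(X,\sigma)$ is the set of homotopy classes of maps $X\to B\mathfrak H$ covering the map $\sigma$.
   Context: $\mathcal H=\mathcal H_+\oplus\mathcal H_-$ is a decomposition of an infinite-dimensional separable complex Hilbert space into isomorphic (infinite-dimensional) subspaces, with $\mathcal H_-$ identified with $\mathcal H_+$. $\mathbf{PU}(\mathcal H_+)$ is the projective unitary group of $\mathcal H_+$ (norm topology), and $B\mathbf{PU}(\mathcal H_+)$ is a model of $K(\mathbb Z,3)$. $\mathbf{Fred}^{sa}_*$ is the space of bounded self-adjoint Fredholm operators with both positive and negative essential spectrum, on which the projective unitary group acts by conjugation (it is homotopy equivalent to $U(\infty)$, which may be used in its place). $K^1(X,\sigma)$ is the set of homotopy classes of sections of $\mathcal P_\sigma\times_{\mathbf{PU}(\mathcal H_+)}\mathbf{Fred}^{sa}_*$, equivalently of equivariant homotopy classes of equivariant maps $\mathcal P_\sigma\to\mathbf{Fred}^{sa}_*$. $\mathbf U_{res}$ is the group of unitary operators on $\mathcal H$ whose off-diagonal blocks with respect to $\mathcal H=\mathcal H_+\oplus\mathcal H_-$ are Hilbert–Schmidt. An element $g\in\mathbf{PU}(\mathcal H_+)$ acts on $\mathbf U_{res}$ by conjugation by $\begin{pmatrix}\hat g&0\\0&\hat g\end{pmatrix}$ for any lift $\hat g\in\mathbf U(\mathcal H_+)$ of $g$.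 $\mathfrak H$ is the resulting semidirect product of $\mathbf{PU}(\mathcal H_+)$ and $\mathbf U_{res}$, with multiplication $(g,h)(g',h')=(gg',h(gh'g^{-1}))$. The classifying space $B\mathfrak H$ is a fibre bundle over $K(\mathbb Z,3)$ with fibre $\mathbf{Fred}^{sa}_*$ (or equivalently $U(\infty)$), written $B\mathfrak H=\mathcal P\times_{\mathbf{PU}(\mathcal H_+)}\mathbf{Fred}^{sa}_*$ with $\mathcal P$ the universal $\mathbf{PU}(\mathcal H_+)$-bundle over $K(\mathbb Z,3)$. A map $X\to B\mathfrak H$ covers $\sigma$ if its composition with the projection $B\mathfrak H\to K(\mathbb Z,3)$ is $\sigma$, and homotopies are through such maps. *)

(* Defs.v *)
From HB Require Import structures.
From mathcomp Require Import all_boot all_order all_algebra.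
From mathcomp Require Import complex ring.
From mathcomp Require Import all_classical all_reals all_analysis.

Set Implicit Arguments.
Unset Strict Implicit.
Unset Printing Implicit Defensive.

Import Order.TTheory GRing.Theory Num.Theory.
Import numFieldNormedType.Exports.

Local Open Scope classical_set_scope.
Local Open Scope ring_scope.

HB.mixin Record isHilbert (R : realType) V & CompleteNormedModule R[i] V := {
  hdot : V -> V -> R[i];
  hdot_linear : forall (a : R[i]) (x y z : V),
    hdot (a *: x + y) z = a * hdot x z + hdot y z;
  hdotC : forall x y : V, hdot y x = (hdot x y)^*;
  hdotxx : forall x : V, hdot x x = `|x| ^+ 2 }.

#[short(type="hilbertType")]
HB.structure Definition Hilbert (R : realType) :=
  {V of CompleteNormedModule R[i] V & isHilbert R V}.

Section HilbertTheory.
Context {R : realType} {H : hilbertType R}.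
Implicit Types (x y z : H) (a : R[i]) (s e f : seq H).

Lemma hdotDl x y z : hdot (x + y) z = hdot x z + hdot y z.
Proof. by have := hdot_linear 1 x y z; rewrite scale1r mul1r. Qed.

Lemma hdot0l z : hdot 0 z = 0.
Proof. by apply: (addrI (hdot 0 z)); rewrite -hdotDl !addr0. Qed.

Lemma hdotZl a x z : hdot (a *: x) z = a * hdot x z.
Proof. by have := hdot_linear a x 0 z; rewrite hdot0l !addr0. Qed.

Lemma hdotNl x z : hdot (- x) z = - hdot x z.
Proof. by rewrite -scaleN1r hdotZl mulN1r. Qed.

Lemma hdotBl x y z : hdot (x - y) z = hdot x z - hdot y z.
Proof. by rewrite hdotDl hdotNl. Qed.

Lemma hdotDr x y z : hdot z (x + y) = hdot z x + hdot z y.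
Proof. by rewrite hdotC hdotDl rmorphD /= -!hdotC. Qed.

Lemma hdotZr a x z : hdot z (a *: x) = a^* * hdot z x.
Proof. by rewrite hdotC hdotZl rmorphM /= -hdotC. Qed.

Lemma hdotNr x z : hdot z (- x) = - hdot z x.
Proof. by rewrite hdotC hdotNl rmorphN /= -hdotC. Qed.

Lemma hdotBr x y z : hdot z (x - y) = hdot z x - hdot z y.
Proof. by rewrite hdotDr hdotNr. Qed.

Lemma hdot0r z : hdot z 0 = 0.
Proof. by rewrite hdotC hdot0l rmorph0. Qed.

Lemma hdot_sumr (I : Type) (r : seq I) (P : pred I) (F : I -> H) z :
  hdot z (\sum_(i <- r | P i) F i) = \sum_(i <- r | P i) hdot z (F i).
Proof.
by elim/big_ind2: _ => [|? ? ? ? <- <-|//]; rewrite ?hdot0r ?hdotDr.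
Qed.

Lemma hdot_suml (I : Type) (r : seq I) (P : pred I) (F : I -> H) z :
  hdot (\sum_(i <- r | P i) F i) z = \sum_(i <- r | P i) hdot (F i) z.
Proof.
by elim/big_ind2: _ => [|? ? ? ? <- <-|//]; rewrite ?hdot0l ?hdotDl.
Qed.

Lemma hdot_eq0 x : (forall y, hdot x y = 0) -> x = 0.
Proof. by move=> /(_ x) /eqP; rewrite hdotxx sqrf_eq0 normr_eq0 => /eqP. Qed.

Lemma hdot_inj x y : (forall z, hdot x z = hdot y z) -> x = y.
Proof.
move=> h; apply/eqP; rewrite -subr_eq0; apply/eqP/hdot_eq0 => z.
by rewrite hdotBl h subrr.
Qed.

Definition in_span s x :=
  exists c : nat -> R[i], x = \sum_(i < size s) c i *: s`_i.

Definition orthonormal s := forall i j, (i < size s)%N -> (j < size s)%N ->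
  hdot s`_i s`_j = (i == j)%:R.

End HilbertTheory.

Definition infinite_dimensional (R : realType) (H : hilbertType R) :=
  ~ exists s : seq H, forall x, in_span s x.

Definition separable (T : topologicalType) :=
  exists2 D : set T, countable D & dense D.


(* Maps V -> V with uniform convergence on the unit ball: on bounded operators
   this is the operator norm topology. *)
Definition opspace (C : numFieldType) (V : normedModType C) :=
  {uniform` [set x : V | `|x| <= 1] -> V}.

Section LinearMaps.
Context {C : pzRingType} {V W : lmodType C} (f : V -> W) (lf : linear f).

Lemma linD x y : f (x + y) = f x + f y.
Proof. by have := lf 1 x y; rewrite !scale1r. Qed.

Lemma lin0 : f 0 = 0.
Proof. by apply: (addrI (f 0)); rewrite -linD !addr0. Qed.

Lemma linZ a x : f (a *: x) = a *: f x.
Proof. by have := lf a x 0; rewrite lin0 !addr0. Qed.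

Lemma linB x y : f (x - y) = f x - f y.
Proof. by rewrite linD -scaleN1r linZ scaleN1r. Qed.

End LinearMaps.

Section UnitaryMaps.
Context {C : numFieldType} {V : normedModType C} (d : V -> V -> C).
Implicit Types u v : V -> V.

Definition is_unitary u :=
  [/\ linear u, bijective u & forall x y, d (u x) (u y) = d x y].

Definition invmap u (y : V) : V := xget 0 [set x | u x = y].

Lemma invmapVK u : bijective u -> cancel (invmap u) u.
Proof.
by case=> g _ gu y; apply: (@xgetPex _ 0 [set x | u x = y]); exists (g y).
Qed.

Lemma invmapK u : bijective u -> cancel u (invmap u).
Proof. by move=> bu x; apply: (bij_inj bu); rewrite invmapVK. Qed.

Lemma is_unitary_id : is_unitary id.
Proof. by split=> //; exists id. Qed.

Lemma is_unitary_comp u v : is_unitary u -> is_unitary v -> is_unitary (u \o v).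
Proof.
case=> lu bu du [lv bv dv]; split.
- by move=> a x y /=; rewrite lv lu.
- exact: bij_comp.
- by move=> x y /=; rewrite du dv.
Qed.

Lemma is_unitary_inv u : is_unitary u -> is_unitary (invmap u).
Proof.
case=> lu bu du; have uK := invmapVK bu; split.
- by move=> a x y; apply: (bij_inj bu); rewrite uK lu !uK.
- by exists u => //; exact: invmapK.
- by move=> x y; rewrite -du !uK.
Qed.

End UnitaryMaps.

Section Conjugation.
Context {C : numFieldType} {V : normedModType C}.
Implicit Types f g T : V -> V.

Definition conjmap f T : V -> V := f \o T \o invmap f.

Lemma invmap_id : invmap (@id V) = id.
Proof.
by apply/funext => x; apply: (@invmapVK _ V id); exists id.
Qed.

Lemma invmap_comp f g : bijective f -> bijective g ->
  invmap (f \o g) = invmap g \o invmap f.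
Proof.
move=> bf bg; have bfg := bij_comp bf bg; apply/funext => x.
by apply: (bij_inj bfg); rewrite invmapVK//= !invmapVK.
Qed.

Lemma conjmap_id T : conjmap id T = T.
Proof. by rewrite /conjmap invmap_id. Qed.

Lemma conjmap_comp f g T : bijective f -> bijective g ->
  conjmap (f \o g) T = conjmap f (conjmap g T).
Proof. by move=> bf bg; rewrite /conjmap invmap_comp. Qed.

Lemma conjmapK f T : bijective f -> conjmap (invmap f) (conjmap f T) = T.
Proof.
move=> bf; have bi : bijective (invmap f).
  by exists f; [exact: invmapVK|exact: invmapK].
rewrite -conjmap_comp// (_ : _ \o _ = id) ?conjmap_id//.
by apply/funext => x /=; rewrite invmapK.
Qed.

Lemma conjmap_scale f g T c : linear f -> bijective f -> bijective g ->
  linear T -> c != 0 -> (forall x, g x = c *: f x) -> conjmap g T = conjmap f T.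
Proof.
move=> lf bf bg lT c0 gf; apply/funext => x; rewrite /conjmap /=.
have -> : invmap g x = c^-1 *: invmap f x.
  apply: (bij_inj bg); rewrite invmapVK// gf linZ// scalerA mulfV// scale1r.
  by rewrite invmapVK.
by rewrite gf linZ// linZ// scalerA mulfV// scale1r.
Qed.

End Conjugation.

Section UnitaryGroup.
Context {R : realType} (H : hilbertType R).

Definition unitaries : set (opspace H) :=
  [set u : opspace H | is_unitary hdot (u : H -> H)].

Definition unitaryGroup := set_type unitaries.
HB.instance Definition _ := Topological.on unitaryGroup.

Definition ufun (u : unitaryGroup) : H -> H := \val u.

Lemma ufunP u : is_unitary hdot (ufun u).
Proof. exact: set_valP. Qed.

Definition mkU (f : H -> H) (hf : is_unitary hdot f) : unitaryGroup :=
  SigSub (mem_set (hf : unitaries f)).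

Lemma mkUE f hf : ufun (@mkU f hf) = f. Proof. by []. Qed.

Lemma ufun_inj : injective ufun. Proof. exact: val_inj. Qed.

Definition umul u v := mkU (is_unitary_comp (ufunP u) (ufunP v)).
Definition uone := mkU (is_unitary_id (@hdot R H)).
Definition uinv u := mkU (is_unitary_inv (ufunP u)).

Lemma umulA : associative umul.
Proof. by move=> u v w; apply: ufun_inj. Qed.

Lemma umul1g : left_id uone umul.
Proof. by move=> u; apply: ufun_inj. Qed.

Lemma umulg1 : right_id uone umul.
Proof. by move=> u; apply: ufun_inj. Qed.

Lemma umulVg : left_inverse uone uinv umul.
Proof.
move=> u; apply: ufun_inj; apply/funext => x.
by rewrite !mkUE/= invmapK//; case: (ufunP u).
Qed.

Lemma umulgV : right_inverse uone uinv umul.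
Proof.
move=> u; apply: ufun_inj; apply/funext => x.
by rewrite !mkUE/= invmapVK//; case: (ufunP u).
Qed.

HB.instance Definition _ := isGroup.Build unitaryGroup
  umulA umul1g umulg1 umulVg umulgV.

End UnitaryGroup.

HB.structure Definition PreTopologicalGroup := {G of Topological G & Group G}.
Notation preTopologicalGroupType := PreTopologicalGroup.type.

Section ProjectiveUnitaryGroup.
Context {R : realType} (H : hilbertType R).
Local Notation U := (unitaryGroup H).
Local Open Scope quotient_scope.

Definition proj_rel (u v : U) : bool :=
  `[< exists2 c : R[i], `|c| = 1 & forall x, ufun v x = c *: ufun u x >].

Lemma proj_relP u v :
  reflect (exists2 c : R[i], `|c| = 1 & forall x, ufun v x = c *: ufun u x)
          (proj_rel u v).
Proof. exact: asboolP. Qed.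

Lemma proj_rel_refl : reflexive proj_rel.
Proof.
by move=> u; apply/proj_relP; exists 1; rewrite ?normr1// => x; rewrite scale1r.
Qed.

Lemma proj_rel_sym : symmetric proj_rel.
Proof.
suff h u v : proj_rel u v -> proj_rel v u by move=> u v; apply/idP/idP; exact: h.
move=> /proj_relP[c c1 h]; have c0 : c != 0 by rewrite -normr_eq0 c1 oner_eq0.
apply/proj_relP; exists c^-1; first by rewrite normfV c1 invr1.
by move=> x; rewrite h scalerA mulVf// scale1r.
Qed.

Lemma proj_rel_trans : transitive proj_rel.
Proof.
move=> v u w /proj_relP[c c1 hc] /proj_relP[e e1 he]; apply/proj_relP.
exists (e * c); first by rewrite normrM c1 e1 mulr1.
by move=> x; rewrite he hc scalerA.
Qed.

Canonical proj_equiv := EquivRel proj_rel proj_rel_refl proj_rel_sym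
  proj_rel_trans.

Definition PU := quotient_topology {eq_quot proj_equiv}.
HB.instance Definition _ := Topological.on PU.
HB.instance Definition _ := Quotient.on PU.

Definition PUlift (g : PU) : U := repr g.

Lemma PU_eqP (u v : U) : \pi_PU u = \pi_PU v <-> proj_rel u v.
Proof. by split=> [/eqquotP//|h]; exact/eqquotP. Qed.

Lemma lift_pi u : proj_rel (PUlift (\pi_PU u)) u.
Proof. by apply/PU_eqP; rewrite reprK. Qed.

Lemma proj_rel_mul u u' v v' : proj_rel u u' -> proj_rel v v' ->
  proj_rel (u * v)%g (u' * v')%g.
Proof.
move=> /proj_relP[c c1 hc] /proj_relP[e e1 he]; apply/proj_relP.
exists (c * e); first by rewrite normrM c1 e1 mulr1.
by have [lu _ _] := ufunP u; move=> x; rewrite !mkUE/= hc he linZ// scalerA.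
Qed.

Lemma proj_rel_inv u u' : proj_rel u u' -> proj_rel u^-1%g u'^-1%g.
Proof.
move=> /proj_relP[c c1 hc]; have c0 : c != 0 by rewrite -normr_eq0 c1 oner_eq0.
apply/proj_relP; exists c^-1; first by rewrite normfV c1 invr1.
have [lu bu _] := ufunP u; have [_ bu' _] := ufunP u'.
move=> x; rewrite !mkUE; apply: (bij_inj bu'); rewrite invmapVK//.
by rewrite hc linZ// invmapVK// scalerA mulfV// scale1r.
Qed.

Definition PUmul (p q : PU) : PU := \pi_PU (PUlift p * PUlift q)%g.
Definition PUinv (p : PU) : PU := \pi_PU (PUlift p)^-1%g.
Definition PUone : PU := \pi_PU 1%g.

Lemma PUmulE u v : PUmul (\pi_PU u) (\pi_PU v) = \pi_PU (u * v)%g.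
Proof. by apply/PU_eqP; apply: proj_rel_mul; exact: lift_pi. Qed.

Lemma PUinvE u : PUinv (\pi_PU u) = \pi_PU u^-1%g.
Proof. by apply/PU_eqP; apply: proj_rel_inv; exact: lift_pi. Qed.

Lemma PUmulA : associative PUmul.
Proof.
elim/quotW=> u; elim/quotW=> v; elim/quotW=> w.
by rewrite (PUmulE v w) (PUmulE u v) (PUmulE u (v * w)%g) (PUmulE (u * v)%g w)
  mulgA.
Qed.

Lemma PUmul1g : left_id PUone PUmul.
Proof. by elim/quotW=> u; rewrite (PUmulE 1%g u) mul1g. Qed.

Lemma PUmulg1 : right_id PUone PUmul.
Proof. by elim/quotW=> u; rewrite (PUmulE u 1%g) mulg1. Qed.

Lemma PUmulVg : left_inverse PUone PUinv PUmul.
Proof. by elim/quotW=> u; rewrite (PUinvE u) (PUmulE u^-1%g u) mulVg. Qed.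

Lemma PUmulgV : right_inverse PUone PUinv PUmul.
Proof. by elim/quotW=> u; rewrite (PUinvE u) (PUmulE u u^-1%g) mulgV. Qed.

HB.instance Definition _ := isGroup.Build PU
  PUmulA PUmul1g PUmulg1 PUmulVg PUmulgV.

Lemma PU_piM u v : \pi_PU (u * v)%g = (\pi_PU u * \pi_PU v)%g.
Proof. by rewrite -(PUmulE u v). Qed.

Lemma PU_pi1 : \pi_PU (1 : U)%g = 1%g. Proof. by []. Qed.

End ProjectiveUnitaryGroup.


Record left_action (G : groupType) (F : Type) := LeftAction {
  lact :> G -> F -> F;
  lact1 : forall x, lact 1%g x = x;
  lactM : forall g h x, lact (g * h)%g x = lact g (lact h x) }.

Section Fredholm.
Context {R : realType} {H : hilbertType R}.
Implicit Types (T u : H -> H) (l : R[i]).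

(* For a bounded operator the closedness of the range follows from the finite
   codimension. *)
Definition fredholm T :=
  (exists s : seq H, forall x, T x = 0 -> in_span s x) /\
  (exists s : seq H, forall y, exists x, in_span s (y - T x)).

Definition ess_spectrum T : set R[i] :=
  [set l | ~ fredholm (fun x => T x - l *: x)].

Definition self_adjoint T := forall x y, hdot (T x) y = hdot x (T y).

Lemma in_span_map u s x : linear u -> in_span s x -> in_span (map u s) (u x).
Proof.
move=> lu [c ->]; exists c; rewrite size_map.
rewrite (big_morph u (linD lu) (lin0 lu)).
by apply: eq_bigr => i _; rewrite linZ// (nth_map 0).
Qed.

Lemma fredholm_conj u T : linear u -> linear T -> bijective u ->
  fredholm T -> fredholm (conjmap u T).
Proof.
move=> lu lT bu [[s hs] [t ht]]; split.
  exists (map u s) => x /= ux0; rewrite -[x](invmapVK bu).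
  apply/in_span_map/hs => //; apply: (bij_inj bu).
  by rewrite lin0.
exists (map u t) => y; have [x hx] := ht (invmap u y); exists (u x).
rewrite -{1}[y](invmapVK bu) /conjmap/= invmapK// -linB//.
exact: in_span_map.
Qed.

Lemma ess_spectrum_conj u T l : linear u -> linear T -> bijective u ->
  ess_spectrum T l -> ess_spectrum (conjmap u T) l.
Proof.
move=> lu lT bu nf f; apply: nf; set S := (X in fredholm X).
have bi : bijective (invmap u) by exists u; [exact: invmapVK|exact: invmapK].
have li : linear (invmap u).
  by move=> a x y; apply: (bij_inj bu); rewrite invmapVK// lu !invmapVK.
have lS : linear S.
  move=> a x y; rewrite /S lT !scalerDr scalerN !scalerA [l * a]mulrC.
  by rewrite opprD addrACA.
rewrite -(conjmapK S bu); apply: fredholm_conj => //.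
  by move=> a x y; rewrite /conjmap/= li lS lu.
congr fredholm : f; apply/funext => x; rewrite /conjmap /S /= (linB lu) (linZ lu).
by rewrite (invmapVK bu).
Qed.

Lemma unitary_continuous u : is_unitary hdot u -> continuous u.
Proof.
case=> lu _ du x; apply/cvgrPdist_lt => e e0; near=> y.
have -> : `|u x - u y| = `|x - y|; last by near: y; exact: cvgr_dist_lt.
by apply/eqP; rewrite -linB// -(eqrXn2 (n:=2))// -!hdotxx du.
Unshelve. all: by end_near. Qed.

End Fredholm.

Section FredSa.
Context {R : realType} (H : hilbertType R).

(* Positive and negative are meant in the partial order of R[i], which forces
   l to be real. *)
Definition fred_sa : set (opspace H) := [set T : opspace H |
  [/\ linear (T : H -> H), continuous (T : H -> H), self_adjoint T,
      fredholm T &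
      (exists2 l, 0 < l & ess_spectrum T l) /\
      (exists2 l, l < 0 & ess_spectrum T l)]].

Definition FredSa := set_type fred_sa.
HB.instance Definition _ := Topological.on FredSa.

Definition fredfun (T : FredSa) : H -> H := \val T.

Lemma fredfunP T : fred_sa (fredfun T).
Proof. exact: set_valP. Qed.

Lemma fredfun_inj : injective fredfun. Proof. exact: val_inj. Qed.

Lemma fred_sa_conj (u : unitaryGroup H) T : fred_sa T ->
  fred_sa (conjmap (ufun u) T).
Proof.
have uu := ufunP u; have [lu bu du] := uu.
have ui := is_unitary_inv uu; have [li bi di] := ui.
case=> lT cT sT fT [[l l0 hl] [k k0 hk]]; split.
- by move=> a x y; rewrite /conjmap/= li lT lu.
- have cu := unitary_continuous uu; have ci := unitary_continuous ui.
  move=> x; apply: (@continuous_comp _ _ _ (T \o _) (ufun u)); last exact: cu.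
  by apply: (@continuous_comp _ _ _ (invmap _) T); [exact: ci|exact: cT].
- move=> x y; rewrite /conjmap/= -{1}[y](invmapVK bu) du sT.
  by rewrite -{2}[x](invmapVK bu) du.
- exact: fredholm_conj.
- by split; [exists l|exists k] => //; exact: ess_spectrum_conj.
Qed.

Definition fred_conj (u : unitaryGroup H) (T : FredSa) : FredSa :=
  SigSub (mem_set (fred_sa_conj u (fredfunP T))).

Lemma fred_conj_rel u v T : proj_rel u v -> fred_conj u T = fred_conj v T.
Proof.
move=> /proj_relP[c c1 h]; apply: fredfun_inj.
have [lu bu _] := ufunP u; have [lv bv _] := ufunP v.
have [lT _ _ _ _] := fredfunP T.
by apply/esym/(@conjmap_scale _ _ _ _ _ c) => //; rewrite -normr_eq0 c1 oner_eq0.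
Qed.

Definition fred_act (g : PU H) : FredSa -> FredSa := fred_conj (PUlift g).

Lemma fred_act1 T : fred_act 1%g T = T.
Proof.
rewrite /fred_act (fred_conj_rel (v := 1%g)); last exact: lift_pi.
by apply: fredfun_inj; exact: conjmap_id.
Qed.

Lemma fred_actM g h T : fred_act (g * h)%g T = fred_act g (fred_act h T).
Proof.
rewrite /fred_act (fred_conj_rel (v := (PUlift g * PUlift h)%g)); last exact: lift_pi.
apply: fredfun_inj; have [_ bu _] := ufunP (PUlift g); have [_ bv _] := ufunP (PUlift h).
exact: conjmap_comp.
Qed.

Definition fred_action : left_action (PU H) FredSa :=
  LeftAction fred_act1 fred_actM.

End FredSa.

Section HilbertSchmidt.
Context {R : realType} {H : hilbertType R}.
Implicit Types (T S A : H -> H) (M : R[i]) (e s : seq H) (x y : H).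

(* The sum over an orthonormal basis is the supremum of the sums over finite
   orthonormal families, so hs_le T M says that the square of the
   Hilbert-Schmidt norm of T is at most M. *)
Definition hs_le T M := forall e, orthonormal e ->
  \sum_(i < size e) `|T e`_i| ^+ 2 <= M.

Definition hilbert_schmidt T := exists M, hs_le T M.

Definition adjoint T S := forall x y, hdot (T x) y = hdot x (S y).

Lemma adjointC T S : adjoint T S -> adjoint S T.
Proof. by move=> a x y; rewrite hdotC -a -hdotC. Qed.

Definition oproj e x : H := \sum_(i < size e) hdot x e`_i *: e`_i.

Lemma hdot_oproj e x j : orthonormal e -> (j < size e)%N ->
  hdot (oproj e x) e`_j = hdot x e`_j.
Proof.
move=> oe je; rewrite hdot_suml (bigD1 (Ordinal je))//= hdotZl oe// eqxx mulr1.
rewrite big1 ?addr0// => i ij; rewrite hdotZl oe//.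
by rewrite (_ : (i == j :> nat) = false) ?mulr0//; apply: contraNF ij.
Qed.

Lemma hdotr_oproj e x y :
  hdot y (oproj e x) = \sum_(i < size e) (hdot x e`_i)^* * hdot y e`_i.
Proof. by rewrite hdot_sumr; apply: eq_bigr => i _; rewrite hdotZr. Qed.

Lemma hdot_oproj_norm e x :
  hdot x (oproj e x) = \sum_(i < size e) `|hdot x e`_i| ^+ 2.
Proof. by rewrite hdotr_oproj; apply: eq_bigr => i _; rewrite sqr_normc mulrC. Qed.

Lemma bessel e x : orthonormal e ->
  \sum_(i < size e) `|hdot x e`_i| ^+ 2 <= `|x| ^+ 2.
Proof.
move=> oe; rewrite -subr_ge0 -hdot_oproj_norm -hdotxx -hdotBr.
have <- : hdot (x - oproj e x) (x - oproj e x) = hdot x (x - oproj e x).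
  rewrite hdotBl -[RHS]subr0; congr (_ - _).
  rewrite hdotC hdotr_oproj big1 ?rmorph0// => i _.
  by rewrite hdotBl hdot_oproj// subrr mulr0.
by rewrite hdotxx exprn_ge0.
Qed.

Lemma gram_schmidt s : exists2 e, orthonormal e & forall x, x \in s -> oproj e x = x.
Proof.
elim: s => [|x s [e oe es]]; first by exists [::].
set r := x - oproj e x.
have re j : (j < size e)%N -> hdot r e`_j = 0.
  by move=> je; rewrite hdotBl hdot_oproj// subrr.
have [r0|r0] := eqVneq r 0.
  exists e => // y; rewrite inE => /predU1P[->|]; last exact: es.
  by apply/esym/eqP; rewrite -subr_eq0 -/r r0.
have nr0 : `|r| != 0 by rewrite normr_eq0.
have nrC : (`|r|^-1)^* = `|r|^-1 :> R[i].
  by apply/CrealP; rewrite rpredV normr_real.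
set q := `|r|^-1 *: r.
have qe j : (j < size e)%N -> hdot q e`_j = 0.
  by move=> je; rewrite hdotZl re// mulr0.
have eq j : (j < size e)%N -> hdot e`_j q = 0.
  by move=> je; rewrite hdotC qe// rmorph0.
have qq : hdot q q = 1.
  by rewrite hdotZl hdotZr nrC hdotxx expr2 mulKf// mulVf.
have qr y : oproj e y = y -> hdot y q = 0.
  move=> <-; rewrite hdot_suml big1// => i _.
  by rewrite hdotZl eq// mulr0.
exists (q :: e).
  move=> [|i] [|j] //=; rewrite ?ltnS => ie je; rewrite ?eqSS.
  - by rewrite qe.
  - by rewrite eq.
  - exact: oe.
move=> y; rewrite inE => yxs; rewrite /oproj /= big_ord_recl /=.
under eq_bigr do rewrite add0n.
rewrite -/(oproj e y); case/predU1P: yxs => [->|ys]; last first.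
  by rewrite qr ?es// scale0r add0r.
have pq : hdot (oproj e x) q = 0.
  by rewrite hdot_suml big1// => i _; rewrite hdotZl eq// mulr0.
have -> : hdot x q = `|r|.
  rewrite -[x](subrK (oproj e x)) -/r hdotDl pq addr0 hdotZr nrC hdotxx.
  by rewrite expr2 mulKf.
by rewrite scalerA mulfV// scale1r /r subrK.
Qed.

Lemma hs_adjoint T S M : adjoint T S -> hs_le T M -> hs_le S M.
Proof.
move=> TS hT f of_; have [e oe es] := gram_schmidt (map S f).
have nS (j : 'I_(size f)) :
    `|S f`_j| ^+ 2 = \sum_(i < size e) `|hdot (T e`_i) f`_j| ^+ 2.
  have pS : oproj e (S f`_j) = S f`_j by apply: es; apply: map_f; exact: mem_nth.
  rewrite -hdotxx -{2}pS hdot_oproj_norm; apply: eq_bigr => i _.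
  by rewrite TS [hdot e`_i _]hdotC norm_conjC.
under eq_bigr do rewrite nS; rewrite exchange_big/=.
apply: le_trans (hT e oe); apply: ler_sum => i _; exact: bessel.
Qed.

Lemma hs_compl A T M : (forall x, `|A x| <= `|x|) -> hs_le T M ->
  hs_le (A \o T) M.
Proof.
move=> hA hT e oe; apply: le_trans (hT e oe); apply: ler_sum => i _ /=.
by rewrite lerXn2r// nnegrE.
Qed.

Lemma hs_compr A A' T T' M : adjoint A A' -> adjoint T T' ->
  (forall x, `|A' x| <= `|x|) -> hs_le T M -> hs_le (T \o A) M.
Proof.
move=> aA aT hA hT; apply: (@hs_adjoint (A' \o T')).
  by move=> x y /=; rewrite (adjointC aA) (adjointC aT).
exact/hs_compl/(hs_adjoint aT).
Qed.

Lemma parallelogram x y :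
  `|x + y| ^+ 2 + `|x - y| ^+ 2 = (`|x| ^+ 2 + `|y| ^+ 2) *+ 2.
Proof.
rewrite -!hdotxx !(hdotDl, hdotDr, hdotNl, hdotNr).
ring.
Qed.

Lemma hs_add T S M N : hs_le T M -> hs_le S N ->
  hs_le (fun x => T x + S x) ((M + N) *+ 2).
Proof.
move=> hT hS e oe.
apply: (@le_trans _ _ (\sum_(i < size e) (`|T e`_i| ^+ 2 + `|S e`_i| ^+ 2) *+ 2)).
  by apply: ler_sum => i _; rewrite -parallelogram lerDl exprn_ge0.
by rewrite sumrMnl big_split lerMn2r lerD ?hT ?hS.
Qed.

End HilbertSchmidt.

Section RestrictedUnitaryGroup.
Context {R : realType} (H : hilbertType R).

(* The Hilbert space H_+ (+) H_-, with H_- identified with H_+; the norm of the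
   product type is equivalent to the one given by pdot. *)
Definition pdot (x y : (H * H)%type) : R[i] := hdot x.1 y.1 + hdot x.2 y.2.

Implicit Types (u v : (H * H)%type -> (H * H)%type).

Definition block11 u : H -> H := fun x => (u (x, 0)).1.
Definition block12 u : H -> H := fun y => (u (0, y)).1.
Definition block21 u : H -> H := fun x => (u (x, 0)).2.
Definition block22 u : H -> H := fun y => (u (0, y)).2.

Definition restricted u := [/\ is_unitary pdot u,
  hilbert_schmidt (block12 u) & hilbert_schmidt (block21 u)].

Lemma pdotxx x : pdot x x = `|x.1| ^+ 2 + `|x.2| ^+ 2.
Proof. by rewrite /pdot !hdotxx. Qed.

Lemma block_comp u v : linear u ->
  [/\ block12 (u \o v) =
        (fun x => (block11 u \o block12 v) x + (block12 u \o block22 v) x) &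
      block21 (u \o v) =
        (fun x => (block21 u \o block11 v) x + (block22 u \o block21 v) x)].
Proof.
move=> lu; have uE x : u x = u (x.1, 0) + u (0, x.2).
  by rewrite -linD//; congr u; case: x => a b; congr pair; rewrite ?addr0 ?add0r.
by split; apply/funext => x; rewrite /block12/block21/= [in LHS]uE.
Qed.

Lemma block_contraction u : is_unitary pdot u ->
  (forall x, `|block11 u x| <= `|x|) /\ (forall x, `|block22 u x| <= `|x|).
Proof.
case=> _ _ du; split=> x; rewrite -(@ler_pXn2r _ 2) ?nnegrE//.
- have := du (x, 0) (x, 0); rewrite !pdotxx/= normr0 expr0n addr0 => <-.
  by rewrite lerDl exprn_ge0.
- have := du (0, x) (0, x); rewrite !pdotxx/= normr0 expr0n add0r => <-.
  by rewrite lerDr exprn_ge0.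
Qed.

Lemma block_adjoint u : is_unitary pdot u ->
  [/\ adjoint (block11 u) (block11 (invmap u)),
      adjoint (block12 u) (block21 (invmap u)),
      adjoint (block21 u) (block12 (invmap u)) &
      adjoint (block22 u) (block22 (invmap u))].
Proof.
case=> _ bu du.
have adj x y : pdot (u x) y = pdot x (invmap u y).
  by rewrite -[pdot x _]du (invmapVK bu).
split=> x y.
- by have := adj (x, 0) (y, 0); rewrite /pdot/= hdot0l hdot0r !addr0.
- by have := adj (0, x) (y, 0); rewrite /pdot/= hdot0l hdot0r addr0 add0r.
- by have := adj (x, 0) (0, y); rewrite /pdot/= hdot0l hdot0r addr0 add0r.
- by have := adj (0, x) (0, y); rewrite /pdot/= hdot0l hdot0r !add0r.
Qed.

Lemma restricted_comp u v : restricted u -> restricted v -> restricted (u \o v).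
Proof.
move=> [uu [M hM] [N hN]] [vv [M' hM'] [N' hN']].
have vi := is_unitary_inv vv.
have [cu11 cu22] := block_contraction uu.
have [cv11 cv22] := block_contraction vi.
have [_ au12 au21 _] := block_adjoint uu.
have [av11 _ _ av22] := block_adjoint vv.
have [lu _ _] := uu; have [e12 e21] := block_comp v lu.
split; first exact: is_unitary_comp.
- rewrite e12; eexists; apply: hs_add.
    exact: hs_compl cu11 hM'.
  exact: hs_compr av22 au12 cv22 hM.
- rewrite e21; eexists; apply: hs_add.
    exact: hs_compr av11 au21 cv11 hN.
  exact: hs_compl cu22 hN'.
Qed.

Lemma restricted_inv u : restricted u -> restricted (invmap u).
Proof.
case=> uu [M hM] [N hN]; have [_ a12 a21 _] := block_adjoint uu.
split; first exact: is_unitary_inv.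
- by exists N; exact: hs_adjoint a21 hN.
- by exists M; exact: hs_adjoint a12 hM.
Qed.

Lemma hs_le0 : hs_le (fun _ : H => 0 : H) 0.
Proof. by move=> e _; rewrite big1// => i _; rewrite normr0 expr0n. Qed.

Definition diag (f : H -> H) (x : (H * H)%type) : (H * H)%type := (f x.1, f x.2).

Lemma restricted_diag f : is_unitary hdot f -> restricted (diag f).
Proof.
case=> lf [g fg gf] df.
have off0 (b : H -> H) : b = (fun=> 0) -> hilbert_schmidt b.
  by move=> ->; exists 0; exact: hs_le0.
split; last 2 first.
- by apply: off0; apply/funext => x; exact: lin0.
- by apply: off0; apply/funext => x; exact: lin0.
split.
- by move=> a [x1 x2] [y1 y2]; rewrite /diag/= !lf.
- by exists (diag g) => -[x y]; rewrite /diag/= ?fg ?gf.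
- by move=> x y; rewrite /pdot/= !df.
Qed.

Lemma restricted_id : restricted id.
Proof.
have -> : id = diag id by apply/funext => -[].
exact/restricted_diag/is_unitary_id.
Qed.

Definition Ures := set_type (restricted : set ((H * H)%type -> (H * H)%type)).
HB.instance Definition _ := Choice.on Ures.

Definition uresfun (h : Ures) : (H * H)%type -> (H * H)%type := \val h.

Lemma uresfunP h : restricted (uresfun h).
Proof. exact: set_valP. Qed.

Lemma uresfun_inj : injective uresfun. Proof. exact: val_inj. Qed.

Definition mkUres u (hu : restricted u) : Ures := SigSub (mem_set hu).

Lemma mkUresE u hu : uresfun (@mkUres u hu) = u. Proof. by []. Qed.

Lemma ures_bij h : bijective (uresfun h).
Proof. by have [[]] := uresfunP h. Qed.

Definition ures_mul g h := mkUres (restricted_comp (uresfunP g) (uresfunP h)).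
Definition ures_one := mkUres restricted_id.
Definition ures_inv h := mkUres (restricted_inv (uresfunP h)).

Lemma ures_mulA : associative ures_mul.
Proof. by move=> u v w; apply: uresfun_inj. Qed.

Lemma ures_mul1g : left_id ures_one ures_mul.
Proof. by move=> u; apply: uresfun_inj. Qed.

Lemma ures_mulg1 : right_id ures_one ures_mul.
Proof. by move=> u; apply: uresfun_inj. Qed.

Lemma ures_mulVg : left_inverse ures_one ures_inv ures_mul.
Proof.
move=> u; apply: uresfun_inj; apply/funext => x.
by rewrite !mkUresE/= invmapK//; exact: ures_bij.
Qed.

Lemma ures_mulgV : right_inverse ures_one ures_inv ures_mul.
Proof.
move=> u; apply: uresfun_inj; apply/funext => x.
by rewrite !mkUresE/= invmapVK//; exact: ures_bij.
Qed.

HB.instance Definition _ := isGroup.Build Ures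
  ures_mulA ures_mul1g ures_mulg1 ures_mulVg ures_mulgV.

(* The usual topology of Ures: operator norm topology, refined by the
   Hilbert-Schmidt norm on the off-diagonal blocks. *)
Definition ures_close (eps : R[i]) (h k : Ures) :=
  [/\ forall x, `|x| <= 1 -> `|uresfun h x - uresfun k x| <= eps,
      hs_le (fun x => block12 (uresfun h) x - block12 (uresfun k) x) (eps ^+ 2) &
      hs_le (fun x => block21 (uresfun h) x - block21 (uresfun k) x) (eps ^+ 2)].

Lemma ures_close_le (d e : R[i]) h k : 0 < d -> d <= e ->
  ures_close d h k -> ures_close e h k.
Proof.
move=> d0 de [h1 h2 h3]; have e0 := lt_le_trans d0 de.
have de2 : d ^+ 2 <= e ^+ 2 by rewrite lerXn2r// nnegrE ltW.
split.
- by move=> x /h1 /le_trans; exact.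
- by move=> f /h2 /le_trans; exact.
- by move=> f /h3 /le_trans; exact.
Qed.

Definition ures_open (A : set Ures) := forall h, A h ->
  exists2 eps : R[i], 0 < eps & forall k, ures_close eps h k -> A k.

Lemma ures_openT : ures_open setT.
Proof. by move=> h _; exists 1. Qed.

Lemma ures_openI : setI_closed ures_open.
Proof.
move=> A B oA oB h [/oA[d d0 hd] /oB[e e0 he]].
have de0 : 0 < d + e by rewrite addr_gt0.
have m0 : 0 < d * e / (d + e) by rewrite divr_gt0// mulr_gt0.
exists (d * e / (d + e)) => // k hk; split.
- apply: hd; apply: ures_close_le hk => //.
  by rewrite ler_pdivrMr// mulrDr lerDr ltW// mulr_gt0.
- apply: he; apply: ures_close_le hk => //.
  by rewrite ler_pdivrMr// mulrDr mulrC lerDl ltW// mulr_gt0.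
Qed.

Lemma ures_open_bigU (I : Type) (f : I -> set Ures) :
  (forall i, ures_open (f i)) -> ures_open (\bigcup_i f i).
Proof.
by move=> of_ h [i _ /of_[e e0 he]]; exists e => // k /he; exists i.
Qed.

HB.instance Definition _ := isOpenTopological.Build Ures
  ures_openT ures_openI ures_open_bigU.

Definition diagU (u : unitaryGroup H) : Ures :=
  mkUres (restricted_diag (ufunP u)).

Definition ures_conj (u : unitaryGroup H) (h : Ures) : Ures :=
  (diagU u * h * (diagU u)^-1)%g.

Lemma ures_conjE (u : unitaryGroup H) h :
  uresfun (ures_conj u h) = conjmap (diag (ufun u)) (uresfun h).
Proof. by []. Qed.

Lemma ures_conj_rel (u v : unitaryGroup H) h : proj_rel u v -> ures_conj u h = ures_conj v h.
Proof.
move=> /proj_relP[c c1 huv]; apply: uresfun_inj; rewrite !ures_conjE.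
have [[ld bd _] _ _] := restricted_diag (ufunP u).
have [[_ bd' _] _ _] := restricted_diag (ufunP v).
have [[lh _ _] _ _] := uresfunP h.
apply/esym/(@conjmap_scale _ _ _ _ _ c) => //.
  by rewrite -normr_eq0 c1 oner_eq0.
by move=> x; rewrite /diag !huv.
Qed.

Lemma diagUM (u v : unitaryGroup H) : diagU (u * v)%g = (diagU u * diagU v)%g.
Proof. by apply: uresfun_inj. Qed.

Lemma diagU1 : diagU 1%g = 1%g.
Proof. by apply: uresfun_inj; apply/funext => -[]. Qed.

Definition ures_act (g : PU H) : Ures -> Ures := ures_conj (PUlift g).

Lemma ures_act1 h : ures_act 1%g h = h.
Proof.
rewrite /ures_act (ures_conj_rel (v := 1%g)); last exact: lift_pi.
by rewrite /ures_conj diagU1 invg1 mul1g mulg1.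
Qed.

Lemma ures_actM g g' h : ures_act (g * g')%g h = ures_act g (ures_act g' h).
Proof.
rewrite /ures_act (ures_conj_rel (v := (PUlift g * PUlift g')%g)); last exact: lift_pi.
by rewrite /ures_conj diagUM invgM !mulgA.
Qed.

Lemma ures_act_mul g h k :
  ures_act g (h * k)%g = (ures_act g h * ures_act g k)%g.
Proof. by rewrite /ures_act /ures_conj !mulgA mulgVK. Qed.

Lemma ures_act_one g : ures_act g 1%g = 1%g.
Proof. by rewrite /ures_act /ures_conj mulg1 mulgV. Qed.

Definition frakH := (PU H * Ures)%type.
HB.instance Definition _ := Topological.copy frakH (PU H * Ures)%type.

Definition frakH_mul (x y : frakH) : frakH :=
  ((x.1 * y.1)%g, (x.2 * ures_act x.1 y.2)%g).
Definition frakH_one : frakH := (1%g, 1%g).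
Definition frakH_inv (x : frakH) : frakH :=
  ((x.1)^-1%g, ures_act (x.1)^-1%g (x.2)^-1%g).

Lemma frakH_mulA : associative frakH_mul.
Proof.
move=> x y z; rewrite /frakH_mul/=.
by rewrite ures_act_mul ures_actM !mulgA.
Qed.

Lemma frakH_mul1g : left_id frakH_one frakH_mul.
Proof. by move=> [g h]; rewrite /frakH_mul/= ures_act1 !mul1g. Qed.

Lemma frakH_mulg1 : right_id frakH_one frakH_mul.
Proof. by move=> [g h]; rewrite /frakH_mul/= ures_act_one !mulg1. Qed.

Lemma frakH_mulVg : left_inverse frakH_one frakH_inv frakH_mul.
Proof.
move=> [g h]; rewrite /frakH_mul/= -ures_act_mul !mulVg.
by rewrite ures_act_one.
Qed.

Lemma frakH_mulgV : right_inverse frakH_one frakH_inv frakH_mul.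
Proof.
by move=> [g h]; rewrite /frakH_mul/= -ures_actM !mulgV ures_act1 mulgV.
Qed.

HB.instance Definition _ := isGroup.Build frakH
  frakH_mulA frakH_mul1g frakH_mulg1 frakH_mulVg frakH_mulgV.

End RestrictedUnitaryGroup.

Section PrincipalBundles.
Context {G : preTopologicalGroupType}.

Definition trivial_over (B E : topologicalType) (proj : E -> B)
    (act : E -> G -> E) (U : set B) :=
  exists (phi : B * G -> E) (psi : E -> G),
  [/\ forall b g, U b -> {for (b, g), continuous phi},
      forall p, U (proj p) -> {for p, continuous psi},
      forall b g, U b -> proj (phi (b, g)) = b /\ psi (phi (b, g)) = g,
      forall p, U (proj p) -> phi (proj p, psi p) = p &
      forall b g h, U b -> phi (b, (g * h)%g) = act (phi (b, g)) h].

Record principal_bundle (B : topologicalType) := PrincipalBundle {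
  pb_total :> topologicalType;
  pb_proj : pb_total -> B;
  pb_act : pb_total -> G -> pb_total;
  pb_proj_cont : continuous pb_proj;
  pb_act_cont : continuous (fun z : pb_total * G => pb_act z.1 z.2);
  pb_act1 : forall p, pb_act p 1%g = p;
  pb_actM : forall p g h, pb_act p (g * h)%g = pb_act (pb_act p g) h;
  pb_proj_act : forall p g, pb_proj (pb_act p g) = pb_proj p;
  pb_loctriv : forall b, exists2 U,
    open_nbhs b U & trivial_over pb_proj pb_act U }.

End PrincipalBundles.
Arguments principal_bundle : clear implicits.

Lemma continuous_pair (S T U : topologicalType) (f : S -> T) (g : S -> U) s :
  {for s, continuous f} -> {for s, continuous g} ->
  {for s, continuous (fun t => (f t, g t))}.
Proof. exact: cvg_pair. Qed.

Section Pullback.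
Context {G : preTopologicalGroupType} {X B : topologicalType}.
Variables (P : principal_bundle G B) (sigma : X -> B).
Hypothesis csigma : continuous sigma.

Definition pullback_set : set (X * P)%type :=
  [set z | sigma z.1 = pb_proj z.2].

Definition pullback_total := set_type pullback_set.
HB.instance Definition _ := Topological.on pullback_total.

Definition pullback_val (z : pullback_total) : (X * P)%type := \val z.
Definition pullback_proj (z : pullback_total) : X := (pullback_val z).1.
Definition pullback_map (z : pullback_total) : P := (pullback_val z).2.

Lemma pullback_valP z : sigma (pullback_proj z) = pb_proj (pullback_map z).
Proof. exact: (set_valP z). Qed.

Lemma pullback_eta z : (pullback_proj z, pullback_map z) = pullback_val z.
Proof. by rewrite /pullback_proj /pullback_map; case: (pullback_val z). Qed.

Definition mk_pullback z (hz : pullback_set z) : pullback_total :=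
  SigSub (mem_set hz).

Lemma pullback_val_inj : injective pullback_val. Proof. exact: val_inj. Qed.

Lemma pullback_act_subproof (z : pullback_total) (g : G) :
  pullback_set (pullback_proj z, pb_act (pullback_map z) g).
Proof. by rewrite /pullback_set/= pb_proj_act pullback_valP. Qed.

Definition pullback_act z g := mk_pullback (pullback_act_subproof z g).

Lemma pullback_val_cont : continuous pullback_val.
Proof. exact: initial_continuous. Qed.

Lemma pullback_into (T : topologicalType) (f : T -> pullback_total) (t : T) :
  {for t, continuous (pullback_val \o f)} -> {for t, continuous f}.
Proof.
move=> cf A [_ /= [[W oW <-] Wft WA]].
have nW : nbhs ((pullback_val \o f) t) W by exact: open_nbhs_nbhs.
have h : nbhs t ((pullback_val \o f) @^-1` W) := cf W nW.
change (nbhs t (f @^-1` A)); apply: filterS h => s Ws; exact: WA.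
Qed.

Lemma pullback_proj_cont : continuous pullback_proj.
Proof.
move=> z; apply: (@continuous_comp _ _ _ pullback_val fst).
  exact: pullback_val_cont.
exact: cvg_fst.
Qed.

Lemma pullback_map_cont : continuous pullback_map.
Proof.
move=> z; apply: (@continuous_comp _ _ _ pullback_val snd).
  exact: pullback_val_cont.
exact: cvg_snd.
Qed.

Lemma pullback_act_cont :
  continuous (fun z : pullback_total * G => pullback_act z.1 z.2).
Proof.
move=> z; apply: pullback_into.
have c1 : {for z, continuous (fun z : pullback_total * G => pullback_proj z.1)}.
  apply: (@continuous_comp _ _ _ fst pullback_proj); first exact: cvg_fst.
  exact: pullback_proj_cont.
have c2 : {for z, continuous (fun z : pullback_total * G => pullback_map z.1)}.
  apply: (@continuous_comp _ _ _ fst pullback_map); first exact: cvg_fst.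
  exact: pullback_map_cont.
have c3 : {for z, continuous
    (fun z : pullback_total * G => pb_act (pullback_map z.1) z.2)}.
  apply: (@continuous_comp _ _ _ (fun z => (pullback_map z.1, z.2))
    (fun z : P * G => pb_act z.1 z.2)); last exact: pb_act_cont.
  by apply: (continuous_pair c2); exact: cvg_snd.
exact: (continuous_pair c1 c3).
Qed.

Lemma pullback_loctriv x : exists2 U,
  open_nbhs x U & trivial_over pullback_proj pullback_act U.
Proof.
have [U [oU Ux] [phi [psi [cphi cpsi phiK psiK phiM]]]] := pb_loctriv P (sigma x).
exists (sigma @^-1` U).
  by split=> //; apply: open_comp => // y _; exact: csigma.
have h0 : pullback_set (x, phi (sigma x, 1%g)).
  by rewrite /pullback_set/=; have [] := phiK _ 1%g Ux.
pose Phi (z : X * G) := insubd (mk_pullback h0) (z.1, phi (sigma z.1, z.2)).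
have PhiE y g : U (sigma y) -> pullback_val (Phi (y, g)) = (y, phi (sigma y, g)).
  move=> Uy; rewrite /pullback_val /Phi val_insubd/= ifT//; apply/mem_set.
  by rewrite /pullback_set/=; have [] := phiK _ g Uy.
exists Phi, (psi \o pullback_map); split.
- move=> y g Uy; apply: pullback_into.
  pose F (z : X * G) := (z.1, phi (sigma z.1, z.2)).
  have cF : {for (y, g), continuous F}.
    apply: continuous_pair; first exact: cvg_fst.
    apply: (@continuous_comp _ _ _ (fun z : X * G => (sigma z.1, z.2)) phi).
      apply: continuous_pair; last exact: cvg_snd.
      by apply: (@continuous_comp _ _ _ fst sigma); [exact: cvg_fst|exact: csigma].
    exact: cphi.
  have FE : \forall z \near (y, g), F z = pullback_val (Phi z).
    have : \forall z \near (y, g), U (sigma z.1).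
      apply: (@continuous_comp _ _ _ fst sigma (y, g)); first exact: cvg_fst.
        exact: csigma.
      exact: open_nbhs_nbhs.
    by apply: filterS => -[z1 z2] Uz; rewrite PhiE.
  rewrite /prop_for /continuous_at /= PhiE//.
  exact: cvg_trans (near_eq_cvg FE) cF.
- move=> z Uz; apply: (@continuous_comp _ _ _ pullback_map psi).
    exact: pullback_map_cont.
  by apply: cpsi; rewrite -pullback_valP.
- move=> y g Uy; rewrite /pullback_proj/= /pullback_map PhiE//=; split=> //.
  by have [] := phiK _ g Uy.
- move=> z Uz; apply: pullback_val_inj; rewrite PhiE//=.
  rewrite pullback_valP psiK ?pullback_eta//.
  by rewrite -pullback_valP.
- move=> y g h Uy; apply: pullback_val_inj; rewrite PhiE//= phiM//.
  by congr pair; rewrite /pullback_proj /pullback_map PhiE.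
Qed.

Lemma pullback_act1 z : pullback_act z 1%g = z.
Proof.
apply: pullback_val_inj; rewrite -[RHS]pullback_eta.
exact: (congr1 (pair (pullback_proj z)) (pb_act1 (pullback_map z))).
Qed.

Lemma pullback_actM z g h :
  pullback_act z (g * h)%g = pullback_act (pullback_act z g) h.
Proof.
apply: pullback_val_inj.
exact: (congr1 (pair (pullback_proj z)) (pb_actM (pullback_map z) g h)).
Qed.

Lemma pullback_proj_act z g : pullback_proj (pullback_act z g) = pullback_proj z.
Proof. by []. Qed.

Definition pullback : principal_bundle G X := PrincipalBundle
  pullback_proj_cont pullback_act_cont pullback_act1 pullback_actM
  pullback_proj_act pullback_loctriv.

End Pullback.

Section AssociatedBundle.
Context {G : preTopologicalGroupType} {B F : topologicalType}.
Variables (P : principal_bundle G B) (a : left_action G F).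

Definition assoc_rel (z w : (P * F)%type) : bool :=
  `[< exists2 g : G, w.1 = pb_act z.1 g & z.2 = a g w.2 >].

Lemma assoc_rel_refl : reflexive assoc_rel.
Proof. by move=> z; apply/asboolP; exists 1%g; rewrite ?pb_act1 ?lact1. Qed.

Lemma assoc_rel_sym : symmetric assoc_rel.
Proof.
suff h z w : assoc_rel z w -> assoc_rel w z by move=> z w; apply/idP/idP; exact: h.
move=> /asboolP[g e1 e2]; apply/asboolP; exists g^-1%g.
  by rewrite e1 -pb_actM mulgV pb_act1.
by rewrite e2 -lactM mulVg lact1.
Qed.

Lemma assoc_rel_trans : transitive assoc_rel.
Proof.
move=> w z v /asboolP[g e1 e2] /asboolP[h e3 e4]; apply/asboolP.
by exists (g * h)%g; rewrite ?pb_actM ?lactM -?e1 -?e4.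
Qed.

Canonical assoc_equiv := EquivRel assoc_rel assoc_rel_refl assoc_rel_sym
  assoc_rel_trans.

(* P x_G F = (P x F) / ((p g, f) ~ (p, g f)) *)
Definition assoc_bundle := quotient_topology {eq_quot assoc_equiv}%qT.
HB.instance Definition _ := Topological.on assoc_bundle.
HB.instance Definition _ := Quotient.on assoc_bundle.

Definition assoc_class (p : P) (f : F) : assoc_bundle :=
  (\pi_assoc_bundle (p, f))%qT.

Definition assoc_proj (z : assoc_bundle) : B := pb_proj (repr z).1.

Lemma assoc_projE p f : assoc_proj (assoc_class p f) = pb_proj p.
Proof.
rewrite /assoc_proj; have : assoc_rel (p, f) (repr (assoc_class p f)).
  apply/eqquotP; exact: (esym (reprK (assoc_class _ f))).
by move=> /asboolP[g /= -> _]; rewrite pb_proj_act.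
Qed.

End AssociatedBundle.
Arguments assoc_proj {G B F} P a z.

(* The map sigma^* P x_G F -> P x_G F, [(x, p), f] |-> [p, f]. *)
Definition pullback_assoc_map (G : preTopologicalGroupType)
    (X B F : topologicalType) (P : principal_bundle G B) (a : left_action G F)
    (sigma : X -> B) (csigma : continuous sigma)
    (z : assoc_bundle (pullback P csigma) a) : assoc_bundle P a :=
  assoc_class a (pullback_map (repr z).1) (repr z).2.

Lemma pullback_assoc_mapE (G : preTopologicalGroupType)
    (X B F : topologicalType) (P : principal_bundle G B) (a : left_action G F)
    (sigma : X -> B) (csigma : continuous sigma) (q : pullback P csigma) (f : F) :
  pullback_assoc_map (assoc_class a q f) = assoc_class a (pullback_map q) f.
Proof.
have : assoc_rel a (q, f) (repr (assoc_class a q f)).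
  apply/eqquotP; exact: (esym (reprK (assoc_class a _ f))).
move=> /asboolP[g /= e1 e2]; apply/esym/eqquotP/asboolP; exists g => //=.
by rewrite e1.
Qed.

Section Lifts.
Variable R : realType.
Context {X E B : topologicalType} (q : E -> B) (s : X -> B).

(* The maps X -> E covering s; for s the identity, the sections of q. *)
Definition lifts : set (X -> E) :=
  [set f | continuous f /\ forall x, q (f x) = s x].

Definition lift_homotopic (f g : X -> E) := exists h : X * R -> E,
  [/\ {within [set z | 0 <= z.2 <= 1], continuous h},
      forall x, h (x, 0) = f x, forall x, h (x, 1) = g x &
      forall x t, 0 <= t <= 1 -> q (h (x, t)) = s x].

Definition lift_class (f : X -> E) : set (X -> E) :=
  [set g | lifts g /\ lift_homotopic f g].

Definition lift_classes : set (set (X -> E)) := lift_class @` lifts.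

End Lifts.

Section TwistedK1.
Context {R : realType} {H : hilbertType R} {X : topologicalType}.
Variable Q : principal_bundle (PU H) X.

Definition fred_bundle : topologicalType := assoc_bundle Q (fred_action H).

Definition fred_proj : fred_bundle -> X := assoc_proj Q (fred_action H).

Definition fred_sections : set (X -> fred_bundle) := lifts fred_proj id.

Definition twistedK1_class (s : X -> fred_bundle) : set (X -> fred_bundle) :=
  lift_class R fred_proj id s.

Definition twistedK1 : set (set (X -> fred_bundle)) :=
  lift_classes R fred_proj id.

End TwistedK1.
Arguments fred_proj {R H X} Q z.
Arguments fred_sections {R H X} Q.
Arguments twistedK1 {R H X} Q.

Section HomotopyGroups.
Variable R : realType.
Context {T : topologicalType}.

Definition cube n : set 'rV[R]_n := [set t | forall i, 0 <= t 0 i <= 1].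

Definition cube_boundary n : set 'rV[R]_n :=
  [set t | cube t /\ exists i, t 0 i = 0 \/ t 0 i = 1].

Definition spheroid n (x0 : T) (f : 'rV[R]_n -> T) :=
  {within @cube n, continuous f} /\ forall t, cube_boundary t -> f t = x0.

Definition spheroid_homotopic n (x0 : T) (f g : 'rV[R]_n -> T) :=
  exists h : 'rV[R]_n * R -> T,
  [/\ {within [set z | cube z.1 /\ 0 <= z.2 <= 1], continuous h},
      forall t, cube t -> h (t, 0) = f t,
      forall t, cube t -> h (t, 1) = g t &
      forall t s, cube_boundary t -> 0 <= s <= 1 -> h (t, s) = x0].

(* For n = 0 this says that T is path connected. *)
Definition trivial_homotopy_group n (x0 : T) :=
  forall f : 'rV[R]_n -> T, spheroid x0 f -> spheroid_homotopic x0 f (cst x0).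

Definition set_coord0 n (t : 'rV[R]_n.+1) (a : R) : 'rV[R]_n.+1 :=
  \row_i (if i == 0 then a else t 0 i).

Definition spheroid_concat n (f g : 'rV[R]_n.+1 -> T) (t : 'rV[R]_n.+1) : T :=
  if t 0 0 <= 2^-1 then f (set_coord0 t (2 * t 0 0))
  else g (set_coord0 t (2 * t 0 0 - 1)).

Definition homotopy_group_iso (A : zmodType) n (x0 : T) :=
  exists c : ('rV[R]_n.+1 -> T) -> A,
  [/\ forall f g, spheroid x0 f -> spheroid x0 g ->
        (c f = c g <-> spheroid_homotopic x0 f g),
      forall a, exists2 f, spheroid x0 f & c f = a &
      forall f g, spheroid x0 f -> spheroid x0 g ->
        c (spheroid_concat f g) = c f + c g].

End HomotopyGroups.

Definition weakly_contractible (R : realType) (T : topologicalType) :=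
  exists x0 : T, forall n, trivial_homotopy_group R n x0.

(* T is a space of type K(A, n.+1). *)
Definition eilenberg_maclane (R : realType) (A : zmodType) n (T : topologicalType) :=
  exists x0 : T, homotopy_group_iso R A n x0 /\
    forall m, m != n.+1 -> trivial_homotopy_group R m x0.

Definition universal_bundle (R : realType) (G : preTopologicalGroupType)
    (B : topologicalType) (E : principal_bundle G B) := weakly_contractible R E.

Definition fibre_homotopy_equivalence (R : realType) (D E B : topologicalType)
    (p : D -> B) (q : E -> B) (f : D -> E) :=
  lifts q p f /\ exists2 g, lifts p q g &
    lift_homotopic R p p (g \o f) id /\ lift_homotopic R q q (f \o g) id.

(* A model of the classifying space of frakH, together with its projection to
   the base K of the universal PU-bundle P, which is the map induced by the
   homomorphism frakH -> PU, and its identification over K with P x_PU FredSa. *)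
Record classifying_frakH (R : realType) (H : hilbertType R) (K : topologicalType)
    (P : principal_bundle (PU H) K) := ClassifyingFrakH {
  bfrakH :> topologicalType;
  bfrakH_bundle : principal_bundle (frakH H) bfrakH;
  bfrakH_universal : universal_bundle R bfrakH_bundle;
  bfrakH_proj : bfrakH -> K;
  bfrakH_proj_cont : continuous bfrakH_proj;
  bfrakH_cover : bfrakH_bundle -> P;
  bfrakH_cover_cont : continuous bfrakH_cover;
  bfrakH_cover_proj : forall e,
    pb_proj (bfrakH_cover e) = bfrakH_proj (pb_proj e);
  bfrakH_cover_act : forall e (x : frakH H),
    bfrakH_cover (pb_act e x) = pb_act (bfrakH_cover e) x.1;
  bfrakH_of_fred : fred_bundle P -> bfrakH;
  bfrakH_of_fredP :
    fibre_homotopy_equivalence R (fred_proj P) bfrakH_proj bfrakH_of_fred }.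
Arguments bfrakH_proj {R H K P} BH : rename.
Arguments bfrakH_of_fred {R H K P} BH : rename.

Section Manifolds.
Variable R : realType.

(* f is of class C^k on the open set D. *)
Fixpoint class_C m n (k : nat) (D : set 'rV[R]_m) (f : 'rV[R]_m -> 'rV[R]_n) :=
  (forall x, D x -> {for x, continuous f}) /\
  (if k is k'.+1 then
     forall v, (forall x, D x -> derivable f x v) /\
               class_C k' D (fun x => 'D_v f x)
   else True).

Definition smooth_on m n (D : set 'rV[R]_m) (f : 'rV[R]_m -> 'rV[R]_n) :=
  forall k, class_C k D f.

(* chart_from is only meaningful on chart_cod, chart_to on chart_dom. *)
Record chart (X : topologicalType) n := Chart {
  chart_dom : set X;
  chart_cod : set 'rV[R]_n;
  chart_to : X -> 'rV[R]_n;
  chart_from : 'rV[R]_n -> X;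
  chart_dom_open : open chart_dom;
  chart_cod_open : open chart_cod;
  chart_to_cont : forall x, chart_dom x -> {for x, continuous chart_to};
  chart_from_cont : forall y, chart_cod y -> {for y, continuous chart_from};
  chart_toP : forall x, chart_dom x ->
    chart_cod (chart_to x) /\ chart_from (chart_to x) = x;
  chart_fromP : forall y, chart_cod y ->
    chart_dom (chart_from y) /\ chart_to (chart_from y) = y }.

Record smooth_manifold n := SmoothManifold {
  manifold_space :> topologicalType;
  manifold_hausdorff : hausdorff_space manifold_space;
  manifold_countable : second_countable (T := manifold_space);
  manifold_atlas : set (chart manifold_space n);
  manifold_cover : forall x, exists2 c, manifold_atlas c & chart_dom c x;
  manifold_smooth : forall c d, manifold_atlas c -> manifold_atlas d ->
    smooth_on (chart_cod c `&` chart_from c @^-1` chart_dom d)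
              (chart_to d \o chart_from c) }.

End Manifolds.

(* Main.v *)
Require Import Defs.
From HB Require Import structures.
From mathcomp Require Import all_boot all_order all_algebra.
From mathcomp Require Import complex lra.
From mathcomp Require Import all_classical all_reals all_analysis.

Set Implicit Arguments.
Unset Strict Implicit.
Unset Printing Implicit Defensive.

Import Order.TTheory GRing.Theory Num.Theory.
Import numFieldNormedType.Exports.

Local Open Scope classical_set_scope.
Local Open Scope ring_scope.

(** A point of the bundle associated with the pullback [sigma^* P] is the same as
    a pair of a point [x] of [X] and a point of [P x_PU FredSa] over [sigma x], so
    a section of [sigma^* P x_PU FredSa] is the same as a map from [X] to
    [P x_PU FredSa] covering [sigma], and a homotopy of sections is the same as a
    homotopy through such maps.  A fibre homotopy equivalence over [K] from
    [P x_PU FredSa] to [B frakH] then induces a bijection between the homotopy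
    classes of maps covering [sigma].  The theorem composes the two bijections.

    What has to be proved in the first step is that the bijection respects
    continuity, that is, that the canonical map from the associated bundle of the
    pullback to [X * (P x_PU FredSa)] is a topological embedding
    ([pullback_assoc_embedding]).  The quotient map from [P * FredSa] to
    [P x_PU FredSa] is the orbit map of a group acting by homeomorphisms, hence it
    is open ([assoc_pi_open]); open neighbourhoods of a representative thus
    project to open sets, which give the neighbourhoods needed for the embedding.
    Each element of [PU] acts continuously on [FredSa] since conjugation by a
    unitary is an isometry for the operator norm ([fred_action_continuous]).

    The second step uses that the homotopy of lifts is an equivalence relation
    stable under composition on either side. *)

(** * Homotopies through lifts *)

Lemma within_continuous_comp (S T U : topologicalType) (A : set S) (B : set T)
    (f : S -> T) (g : T -> U) :
  {within A, continuous f} -> {within B, continuous g} ->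
  (forall x, A x -> B (f x)) -> {within A, continuous (g \o f)}.
Proof.
move=> /subspace_continuousP cf /subspace_continuousP cg AB.
apply/subspace_continuousP => x Ax W nW.
have := cf x Ax _ (cg (f x) (AB x Ax) W nW); rewrite !/nbhs/= /within/=.
by apply: filterS => y h Ay; apply: (h Ay); exact: AB.
Qed.

Section LiftHomotopy.
Variable R : realType.
Context {X E B : topologicalType} (q : E -> B) (s : X -> B).
Local Notation "f ~ g" := (lift_homotopic R q s f g) (at level 70).

Lemma lift_homotopic_refl f : lifts q s f -> f ~ f.
Proof.
case=> cf qf; exists (f \o fst); split=> [|//|//|x t _]; last exact: qf.
apply: continuous_subspaceT => z.
by apply: continuous_comp; [exact: cvg_fst | exact: cf].
Qed.

Lemma lift_homotopic_sym f g : f ~ g -> g ~ f.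
Proof.
case=> h [ch h0 h1 qh]; exists (fun z => h (z.1, 1 - z.2)); split.
- apply: (within_continuous_comp (f := fun z : X * R => (z.1, 1 - z.2)) _ ch).
    apply: continuous_subspaceT => z; apply: continuous_pair; first exact: cvg_fst.
    by apply: cvgB; [exact: cvg_cst | exact: cvg_snd].
  by move=> [x t] /= ht; lra.
- by move=> x; rewrite /= subr0.
- by move=> x; rewrite /= subrr.
- by move=> x t ht /=; apply: qh; lra.
Qed.

Lemma lift_homotopic_trans f g k : f ~ g -> g ~ k -> f ~ k.
Proof.
case=> h [ch h0 h1 qh] [l [cl l0 l1 ql]].
pose m (z : X * R) :=
  if z.2 <= 2^-1 then h (z.1, 2 * z.2) else l (z.1, 2 * z.2 - 1).
pose I1 := [set z : X * R | 0 <= z.2 <= 2^-1].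
pose I2 := [set z : X * R | 2^-1 <= z.2 <= 1].
have closed_strip a b : closed [set z : X * R | a <= z.2 <= b].
  have -> : [set z : X * R | a <= z.2 <= b] = snd @^-1` `[a, b]%classic.
    by apply/seteqP; split=> z /=; rewrite in_itv.
  by apply: closed_comp; [move=> z _; exact: cvg_snd | exact: itv_closed].
have cscale : continuous (fun z : X * R => 2 * z.2).
  by move=> z; apply: cvgM; [exact: cvg_cst | exact: cvg_snd].
(* The two halves of the cylinder are closed, so continuity can be pasted. *)
exists m; split.
- rewrite (_ : [set z | _] = I1 `|` I2); last first.
    apply/seteqP; split=> -[x t]; rewrite /I1 /I2 /=; last by case=> ht; lra.
    move=> ht; have [|] := lerP t 2^-1; [left|right]; lra.
  apply: withinU_continuous; [exact: closed_strip|exact: closed_strip| |].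
    apply: (@subspace_eq_continuous _ _ _ (h \o (fun z => (z.1, 2 * z.2)))).
      by move=> z; rewrite inE /I1 /from_subspace /m => /andP[_ ht] /=; rewrite ht.
    apply: within_continuous_comp ch _.
      apply: continuous_subspaceT => z.
      by apply: continuous_pair; [exact: cvg_fst|exact: cscale].
    by move=> [x t]; rewrite /I1 /= => ht; lra.
  apply: (@subspace_eq_continuous _ _ _ (l \o (fun z => (z.1, 2 * z.2 - 1)))).
    move=> [x t]; rewrite inE /I2 /from_subspace /m/= => ht; case: ifP => // ht'.
    have -> : t = 2^-1 by apply/eqP; rewrite eq_le ht'; case/andP: ht.
    by rewrite mulfV ?pnatr_eq0// subrr l0 h1.
  apply: within_continuous_comp cl _.
    apply: continuous_subspaceT => z; apply: continuous_pair; first exact: cvg_fst.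
    by apply: cvgB; [exact: cscale|exact: cvg_cst].
  by move=> [x t]; rewrite /I2 /= => ht; lra.
- by move=> x; rewrite /m/= ifT ?mulr0//; lra.
- move=> x; rewrite /m/= ifF; last by apply/negbTE; rewrite -ltNge; lra.
  by rewrite -l1; congr (l (_, _)); lra.
- move=> x t ht; rewrite /m/=; case: (lerP t 2^-1) => ht'; [apply: qh|apply: ql];
  lra.
Qed.

Lemma lift_class_eq f g : lifts q s f -> lifts q s g ->
  lift_class R q s f = lift_class R q s g <-> f ~ g.
Proof.
move=> lf lg; split=> [fg|fg].
  suff [] : lift_class R q s f g by [].
  by rewrite fg; split=> //; exact: lift_homotopic_refl.
apply/seteqP; split=> k [lk hk]; split=> //.
  exact: lift_homotopic_trans (lift_homotopic_sym fg) hk.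
exact: lift_homotopic_trans fg hk.
Qed.

End LiftHomotopy.

(** * Maps of lifts inducing bijections of homotopy classes *)

Section LiftClassesBijection.
Variable R : realType.
Context {X E B E' B' : topologicalType}.
Variables (q : E -> B) (s : X -> B) (q' : E' -> B') (s' : X -> B').
Variable T : (X -> E) -> (X -> E').

(** The value of [Phi] on a class is defined by saturation rather than by a
    choice of a representative, so that it is the full homotopy class of the
    image of any representative. *)
Lemma lift_classes_bij :
  (forall f, lifts q s f -> lifts q' s' (T f)) ->
  (forall f g, lifts q s f -> lifts q s g ->
     lift_homotopic R q s f g <-> lift_homotopic R q' s' (T f) (T g)) ->
  (forall k, lifts q' s' k ->
     exists2 f, lifts q s f & lift_homotopic R q' s' (T f) k) ->
  exists Phi, set_bij (lift_classes R q s) (lift_classes R q' s') Phi /\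
    forall f, lifts q s f -> Phi (lift_class R q s f) = lift_class R q' s' (T f).
Proof.
move=> Tl Th Ts.
pose Phi (C : set (X -> E)) : set (X -> E') :=
  [set k | lifts q' s' k /\ exists2 f, C f & lift_homotopic R q' s' (T f) k].
have PhiE f : lifts q s f -> Phi (lift_class R q s f) = lift_class R q' s' (T f).
  move=> lf; apply/seteqP; split=> k [lk hk]; split=> //.
    case: hk => g [lg fg] gk; apply: lift_homotopic_trans gk.
    exact/Th.
  by exists f => //; split=> //; exact: lift_homotopic_refl.
exists Phi; split=> //; split.
- by move=> _ [f lf <-]; rewrite PhiE//; exists (T f) => //; exact: Tl.
- move=> _ _ /set_mem[f lf <-] /set_mem[g lg <-]; rewrite !PhiE//.
  move=> /lift_class_eq -/(_ (Tl _ lf) (Tl _ lg)) /Th h.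
  by apply/lift_class_eq => //; exact: h.
- move=> _ [k lk <-]; have [f lf fk] := Ts k lk.
  exists (lift_class R q s f); first by exists f.
  by rewrite PhiE//; apply/lift_class_eq => //; exact: Tl.
Qed.

End LiftClassesBijection.

Section LiftComposition.
Variable R : realType.
Context {X D E B : topologicalType} (p : D -> B) (q : E -> B) (s : X -> B).

Lemma lifts_comp (f : D -> E) k : lifts q p f -> lifts p s k -> lifts q s (f \o k).
Proof.
move=> [cf qf] [ck pk]; split=> [x|x] /=; last by rewrite qf.
by apply: continuous_comp; [exact: ck|exact: cf].
Qed.

Lemma lift_homotopic_compl (f : D -> E) k l : lifts q p f ->
  lift_homotopic R p s k l -> lift_homotopic R q s (f \o k) (f \o l).
Proof.
move=> [cf qf] [h [ch h0 h1 qh]]; exists (f \o h); split=> [|x|x|x t ht] /=.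
- apply: (within_continuous_comp ch (B := setT)) => //.
  exact: continuous_subspaceT.
- by rewrite h0.
- by rewrite h1.
- by rewrite qf qh.
Qed.

Lemma lift_homotopic_compr (f g : D -> E) k : lifts p s k ->
  lift_homotopic R q p f g -> lift_homotopic R q s (f \o k) (g \o k).
Proof.
move=> [ck pk] [h [ch h0 h1 qh]].
exists (h \o (fun z => (k z.1, z.2))); split=> [|x|x|x t ht] /=.
- apply: within_continuous_comp ch _ => //.
  apply: continuous_subspaceT => z; apply: continuous_pair; last exact: cvg_snd.
  by apply: continuous_comp; [exact: cvg_fst|exact: ck].
- by rewrite h0.
- by rewrite h1.
- by rewrite qh.
Qed.

End LiftComposition.

Section FibreHomotopyEquivalence.
Variable R : realType.
Context {X D E B : topologicalType} {p : D -> B} {q : E -> B} {f : D -> E}.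

(** If [g] is an inverse of [f], then [k ~ g f k ~ g f l ~ l] as soon as
    [f k ~ f l]. *)
Lemma fibre_homotopy_equivalence_homotopicE (s : X -> B) k l :
  fibre_homotopy_equivalence R p q f -> lifts p s k -> lifts p s l ->
  lift_homotopic R p s k l <-> lift_homotopic R q s (f \o k) (f \o l).
Proof.
move=> [lf [g lg [gf _]]] lk ll; split; first exact: lift_homotopic_compl.
move=> /(lift_homotopic_compl lg) h.
apply: lift_homotopic_trans (lift_homotopic_compr ll gf).
exact: lift_homotopic_trans (lift_homotopic_sym (lift_homotopic_compr lk gf)) h.
Qed.

Lemma fibre_homotopy_equivalence_surj (s : X -> B) k :
  fibre_homotopy_equivalence R p q f -> lifts q s k ->
  exists2 l, lifts p s l & lift_homotopic R q s (f \o l) k.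
Proof.
move=> [lf [g lg [_ fg]]] lk; exists (g \o k); first exact: lifts_comp lg lk.
exact: lift_homotopic_compr lk fg.
Qed.

End FibreHomotopyEquivalence.

(** * The quotient map of an associated bundle *)

Section AssociatedBundle.
Context {G : preTopologicalGroupType} {B F : topologicalType}.
Variables (P : principal_bundle G B) (a : left_action G F).
Hypothesis ca : forall g, continuous (a g).

Lemma assoc_classE (p p' : P) f f' :
  assoc_class a p f = assoc_class a p' f' <->
  exists2 g, p' = pb_act p g & f = a g f'.
Proof.
split; first by move=> /eqquotP /asboolP.
by move=> h; apply/eqquotP/asboolP.
Qed.

Lemma assoc_class_surj (z : assoc_bundle P a) : exists p f, z = assoc_class a p f.
Proof.
exists (repr z).1, (repr z).2.
by rewrite /assoc_class -surjective_pairing reprK.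
Qed.

(** The action of [G] on [P * F] whose orbits are the classes of the associated
    bundle, in the form of a left action. *)
Definition assoc_shift (g : G) (z : P * F) : P * F := (pb_act z.1 g^-1%g, a g z.2).

Lemma assoc_shift_cont g : continuous (assoc_shift g).
Proof.
move=> z.
have c1 : {for z, continuous (fun z : P * F => pb_act z.1 g^-1%g)}.
  apply: (@continuous_comp _ _ _ (fun z : P * F => (z.1, g^-1%g))
    (fun z : P * G => pb_act z.1 z.2)); last exact: pb_act_cont.
  by apply: continuous_pair; [exact: cvg_fst|exact: cvg_cst].
have c2 : {for z, continuous (fun z : P * F => a g z.2)}.
  by apply: (@continuous_comp _ _ _ snd (a g)); [exact: cvg_snd|exact: ca].
exact: (continuous_pair c1 c2).
Qed.

(** The saturation of an open set is the union of its translates under the group,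
    each of which is open. *)
Lemma assoc_pi_open (V : set (P * F)) : open V ->
  open ((fun z => assoc_class a z.1 z.2) @` V).
Proof.
move=> oV; set A := (X in open X).
have AE : (\pi_(assoc_bundle P a) @^-1` A)%qT = \bigcup_g (assoc_shift g @^-1` V).
  apply/seteqP; split=> -[p' f'] /=.
    move=> [[p f] Vz /assoc_classE[g e1 e2]]; exists g => //=.
    by rewrite /assoc_shift e1 -e2 -pb_actM mulgV pb_act1.
  move=> [g _ Vz]; exists (assoc_shift g (p', f')) => //.
  by apply/assoc_classE; exists g => //=; rewrite -pb_actM mulVg pb_act1.
rewrite /open/= /quotient_open AE; apply: bigcup_open => g _.
by apply: open_comp => // z _; exact: assoc_shift_cont.
Qed.

End AssociatedBundle.

(** * The associated bundle of a pullback *)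

Section AssociatedPullback.
Context {G : preTopologicalGroupType} {X B F : topologicalType}.
Variables (P : principal_bundle G B) (a : left_action G F).
Hypothesis ca : forall g, continuous (a g).
Variables (sigma : X -> B) (csigma : continuous sigma).
Local Notation Q := (pullback P csigma).
Local Notation m := (@pullback_assoc_map G X B F P a sigma csigma).

Lemma pullback_assoc_proj w : assoc_proj P a (m w) = sigma (assoc_proj Q a w).
Proof. by rewrite assoc_projE -pullback_valP. Qed.

Lemma pullback_assoc_map_cont : continuous m.
Proof.
apply/quotient_continuous.
have -> : m \o \pi_(assoc_bundle Q a)%qT =
    \pi_(assoc_bundle P a)%qT \o (fun z : Q * F => (pullback_map z.1, z.2)).
  by apply/funext => -[q f]; exact: pullback_assoc_mapE.
move=> z; apply: continuous_comp; last exact: pi_continuous.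
apply: continuous_pair; last exact: cvg_snd.
by apply: continuous_comp; [exact: cvg_fst|exact: pullback_map_cont].
Qed.

(** Together with the next lemma: the fibre of the associated bundle of the
    pullback over [x] is mapped bijectively to the fibre over [sigma x]. *)
Lemma pullback_assoc_inj w w' :
  assoc_proj Q a w = assoc_proj Q a w' -> m w = m w' -> w = w'.
Proof.
have [q [f ->]] := assoc_class_surj w; have [q' [f' ->]] := assoc_class_surj w'.
rewrite !assoc_projE !pullback_assoc_mapE => exx /assoc_classE[g e1 e2].
apply/assoc_classE; exists g => //; apply: pullback_val_inj.
by rewrite -pullback_eta e1; congr pair.
Qed.

Lemma pullback_assoc_surj x z : assoc_proj P a z = sigma x ->
  exists w, assoc_proj Q a w = x /\ m w = z.
Proof.
have [p [f ->]] := assoc_class_surj z; rewrite assoc_projE => px.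
have h : pullback_set sigma (x, p) by rewrite /pullback_set/= px.
exists (assoc_class a (mk_pullback h : Q) f).
by rewrite assoc_projE pullback_assoc_mapE.
Qed.

(** Given a representative [(q, f)] of [w], the set [A] contains the classes of all
    [((x, p), d)] with [x] in some [V], [p] in some [W'] and [d] in some [D].  As
    the image of [W' * D] in the associated bundle of [P] is open, the conditions
    [x \in V] and [m w' \in image of (W' * D)] define a neighbourhood of [w]. *)
Lemma pullback_assoc_embedding w (A : set (assoc_bundle Q a)) : nbhs w A ->
  exists V W, [/\ nbhs (assoc_proj Q a w) V, nbhs (m w) W &
    forall w', V (assoc_proj Q a w') -> W (m w') -> A w'].
Proof.
have [q [f ->]] := assoc_class_surj w; rewrite assoc_projE pullback_assoc_mapE.
move=> /(@pi_continuous _ _ (q, f)) [[C1 C2] [nC1 nC2] hC].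
have [_ [[N oN <-] Nq NC1]] := nC1.
have [[V W] [nV nW] VWN] : nbhs (pullback_val q) N by exact: open_nbhs_nbhs.
have := nW; rewrite {1}nbhsE => -[W' [oW' W'q] W'W].
have := nC2; rewrite {1}nbhsE => -[D [oD Df] DC2].
exists V, ((fun z => assoc_class a z.1 z.2) @` (W' `*` D)); split.
- exact: nV.
- apply: open_nbhs_nbhs; split; last by exists (pullback_map q, f).
  apply: assoc_pi_open => //.
  rewrite (_ : _ `*` _ = fst @^-1` W' `&` snd @^-1` D)//.
  by apply: openI; apply: open_comp => // z _; [exact: cvg_fst|exact: cvg_snd].
move=> w'; have [q' [f' ->]] := assoc_class_surj w'.
rewrite assoc_projE pullback_assoc_mapE => Vq' [[p d] /= [W'p Dd] e].
have /assoc_classE[g e1 e2] := e.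
(* The representative of [w'] given by [(q', f')] need not be near [(q, f)];
   it is replaced by one that is. *)
have hp : pullback_set sigma (pullback_proj q', p).
  by rewrite /pullback_set/= pullback_valP e1 pb_proj_act.
have -> : assoc_class a q' f' = assoc_class a (mk_pullback hp : Q) d.
  by apply: pullback_assoc_inj; rewrite ?assoc_projE ?pullback_assoc_mapE.
apply: (hC (_, _)); split => /=; last exact: DC2.
by apply: NC1; apply: VWN; split=> //; exact: W'W.
Qed.

(** The form in which the embedding is used: on all of [X] it makes sections
    continuous, on the strip of a cylinder it does the same for homotopies. *)
Lemma within_continuous_pullback_assoc (S : topologicalType) (D : set S)
    (h : S -> assoc_bundle Q a) :
  {within D, continuous (assoc_proj Q a \o h)} -> {within D, continuous (m \o h)} ->
  {within D, continuous h}.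
Proof.
move=> /subspace_continuousP cp /subspace_continuousP cm.
apply/subspace_continuousP => y Dy A /pullback_assoc_embedding[V [W [nV nW VWA]]].
have nV' := cp y Dy V nV; have nW' := cm y Dy W nW.
move: nV' nW'; rewrite !/nbhs/= /within/=.
by apply: filterS2 => y' Vy Wy Dy'; apply: VWA; [exact: Vy|exact: Wy].
Qed.

Variable R : realType.

Lemma section_lifts s : lifts (assoc_proj Q a) id s ->
  lifts (assoc_proj P a) sigma (m \o s).
Proof.
move=> [cs ps]; split=> x /=; last by rewrite pullback_assoc_proj ps.
by apply: continuous_comp; [exact: cs|exact: pullback_assoc_map_cont].
Qed.

Lemma lift_section k : lifts (assoc_proj P a) sigma k ->
  exists2 s, lifts (assoc_proj Q a) id s & m \o s = k.
Proof.
move=> [ck pk].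
have /choice[s hs] x : exists w, assoc_proj Q a w = x /\ m w = k x.
  exact: pullback_assoc_surj.
have ms : m \o s = k by apply/funext => x /=; case: (hs x).
exists s => //; split=> [|x]; last by case: (hs x).
rewrite continuous_subspace_setT; apply: within_continuous_pullback_assoc.
  rewrite (_ : _ \o s = id); last by apply/funext => x /=; case: (hs x).
  by apply: continuous_subspaceT => x; exact: cvg_id.
by rewrite ms; exact: continuous_subspaceT.
Qed.

(** Conversely to the composition with [m], a homotopy covering [sigma] is lifted
    pointwise.  Its values outside the unit interval of times are unconstrained and
    may not lie over [sigma]; there the lift is given the values of [s]. *)
Lemma section_homotopicE s s' :
  lifts (assoc_proj Q a) id s -> lifts (assoc_proj Q a) id s' ->
  lift_homotopic R (assoc_proj Q a) id s s' <->
  lift_homotopic R (assoc_proj P a) sigma (m \o s) (m \o s').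
Proof.
move=> [cs ps] [cs' ps']; split=> [[h [ch h0 h1 ph]]|[h [ch h0 h1 ph]]].
  exists (m \o h); split=> [|x|x|x t ht] /=.
  - apply: (within_continuous_comp ch (B := setT)) => //.
    by apply: continuous_subspaceT; exact: pullback_assoc_map_cont.
  - by rewrite h0.
  - by rewrite h1.
  - by rewrite pullback_assoc_proj ph.
pose I := [set z : X * R | 0 <= z.2 <= 1].
have /choice[k hk] z : exists w, I z -> assoc_proj Q a w = z.1 /\ m w = h z.
  have [Iz|nIz] := pselect (I z); last by exists (s z.1).
  have [|w hw] := @pullback_assoc_surj z.1 (h z); last by exists w.
  by case: z Iz => x t; exact: ph.
exists k; split=> [|x|x|x t ht].
- apply: within_continuous_pullback_assoc.
    apply: (@subspace_eq_continuous _ _ _ (fst : X * R -> X)).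
      by move=> z; rewrite inE => /hk[e _]; exact: (esym e).
    by apply: continuous_subspaceT => z; exact: cvg_fst.
  apply: (@subspace_eq_continuous _ _ _ h) => //.
  by move=> z; rewrite inE => /hk[_ e]; exact: (esym e).
- have [|e1 e2] := hk (x, 0); first by rewrite /I/= lexx ler01.
  by apply: pullback_assoc_inj; rewrite ?e1 ?e2 ?ps ?h0.
- have [|e1 e2] := hk (x, 1); first by rewrite /I/= lexx ler01.
  by apply: pullback_assoc_inj; rewrite ?e1 ?e2 ?ps' ?h1.
- by have [] := hk (x, t).
Qed.

End AssociatedPullback.

(** * Continuity of the conjugation action on Fredholm operators *)

Section FredActionContinuous.
Context {R : realType} {H : hilbertType R}.

Lemma is_unitary_norm (u : H -> H) x : Defs.is_unitary hdot u -> `|u x| = `|x|.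
Proof.
by case=> _ _ du; apply/eqP; rewrite -(eqrXn2 (n:=2))// -!hdotxx du.
Qed.

(** For [x] in the unit ball, [u T' u^-1 x - u T u^-1 x] has the same norm as
    [T' y - T y] with [y = u^-1 x], which is in the unit ball too. *)
Lemma conjmap_continuous (u : unitaryGroup H) :
  continuous (conjmap (ufun u) : opspace H -> opspace H).
Proof.
move=> T A /uniform_nbhs[E [entE EA]].
have [e e0 eE] : exists2 e : R[i], 0 < e & forall x y : H, ball x e y -> E (x, y).
  move: entE; rewrite -entourage_ballE => -[e /= e0 eE]; exists e => // x y xy.
  exact: (eE (x, y)).
apply/uniform_nbhs; exists [set z | ball z.1 e z.2]; split.
  by rewrite -entourage_ballE; exists e.
move=> T' h; apply: EA => x /= x1; apply: eE; rewrite -ball_normE /ball_/=.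
have uu := ufunP u; have [lu _ _] := uu.
rewrite /conjmap/= -linB// is_unitary_norm//.
have := h (invmap (ufun u) x); rewrite -ball_normE /ball_/=; apply.
by rewrite is_unitary_norm//; exact: is_unitary_inv.
Qed.

Lemma fred_action_continuous (g : PU H) : continuous (fred_action H g).
Proof.
apply: continuous_comp_initial => T.
have cT : {for T, continuous (@fredfun R H : FredSa H -> opspace H)}.
  exact: initial_continuous.
exact: (continuous_comp cT (@conjmap_continuous (PUlift g) _)).
Qed.

End FredActionContinuous.

(** * Twisted K-theory and lifts to the classifying space *)

Theorem theorem3p12 (R : realType) (Hplus : hilbertType R)
    (sepH : separable Hplus) (infH : infinite_dimensional Hplus)
    (K : topologicalType) (KZ3 : eilenberg_maclane R int 2 K)
    (P : principal_bundle (PU Hplus) K) (univP : universal_bundle R P)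
    (BH : classifying_frakH P)
    (n : nat) (X : smooth_manifold R n) (compactX : compact [set: X])
    (sigma : X -> K) (csigma : continuous sigma) :
  exists Phi : set (X -> fred_bundle (pullback P csigma)) -> set (X -> BH),
    set_bij (twistedK1 (pullback P csigma))
            (lift_classes R (bfrakH_proj BH) sigma) Phi /\
    forall s, fred_sections (pullback P csigma) s ->
      Phi (twistedK1_class s) =
      lift_class R (bfrakH_proj BH) sigma
        (fun x => bfrakH_of_fred BH (pullback_assoc_map (s x))).
Proof.
have fe := bfrakH_of_fredP BH; have [lf _] := fe.
have ca := @fred_action_continuous R Hplus.
apply: (lift_classes_bij
  (T := fun s x => bfrakH_of_fred BH (pullback_assoc_map (s x)))).
- by move=> s ls; exact: lifts_comp lf (section_lifts ls).
- move=> s t ls lt; apply: iff_trans (section_homotopicE ca R ls lt) _.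
  by apply: fibre_homotopy_equivalence_homotopicE => //; exact: section_lifts.
- move=> k /(fibre_homotopy_equivalence_surj fe)[l ll lk].
  by have [s ls sl] := lift_section ca csigma ll; exists s => //; rewrite -sl in lk.
Qed.
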